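(* For every integer $t\ge 0$ there is an integer $N$ such that for all $n\ge N$ the face $F_{\lfloor n/2\rfloor-t}$ of the cone of F-nef $\mathfrak{S}_n$-invariant divisors on $\overline{M}_{0,n}$ is a simplex.
   Context: $\overline{M}_{0,n}$ is the moduli space of stable $n$-pointed genus $0$ curves. For $2\le j\le\lfloor n/2\rfloor$, $D_j$ is the boundary divisor parameterizing curves with a node separating $j$ marked points from the other $n-j$. The $D_j$ form a basis of the space of $\mathfrak{S}_n$-invariant $\mathbb{Q}$-divisor classes; write such a class as $\sum_{j=2}^{\lfloor n/2\rfloor}r_jD_j$, and set $r_1=0$ and $r_{n-j}=r_j$. Let $W=\mathbb{P}(\mathbb{Q}^{\lfloor n/2\rfloor-1})$ be the projectivization of this space, with coordinates $(r_2,\dots,r_{\lfloor n/2\rfloor})$. Let $F\subset W$ be the (projectivized) cone of F-nef divisors, i.e. those meeting every vital curve nonnegatively (a vital curve is an irreducible component of the locus of curves with at least $n-4$ nodes); explicitly $F$ is given by the inequalities $$r_{a+b}+r_{a+c}+r_{a+d}-r_a-r_b-r_c-r_d\ge0$$ for all partitions $a+b+c+d=n$ into positive integers. For $1\le i\le\lfloor n/2\rfloor-1$, $V_i\subset W$ is the hyperplane corresponding to the partition $1+1+i+(n-i-2)=n$, i.e. $r_2+2r_{i+1}-r_i-r_{i+2}=0$. For $2\le k\le\lfloor n/2\rfloor$ set $$F_k=V_1\cap V_2\cap\dots\cap V_{k-2}\cap F ,$$ so $F_2=F$. ''Simplex'' is meant projectively: the corresponding cone in $\mathbb{Q}^{\lfloor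 n/2\rfloor-1}$ is spanned by linearly independent rays. *)

(* Defs.v *)
From mathcomp Require Import all_boot all_order all_algebra.
Set Implicit Arguments.
Unset Strict Implicit.
Unset Printing Implicit Defensive.
Import Order.TTheory GRing.Theory Num.Theory.
Local Open Scope ring_scope.

(* The class \sum_(2 <= j <= n./2) r_j D_j, represented by its coordinates in
   the basis of the boundary divisors D_2, ..., D_(n./2): the entry of index i
   is r_(i + 2). *)
Definition symdiv (n : nat) : Type := 'rV[rat]_(n./2.-1).

(* r_j, extended by r_(n - j) = r_j and r_1 = 0.  For 1 <= j <= n - 1 the sum
   has exactly one term, except that it is empty for j = 1 and j = n - 1. *)
Definition bcoef (n : nat) (D : symdiv n) (j : nat) : rat :=
  \sum_(i < n./2.-1 | i.+2 == minn j (n - j)) D 0 i.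

(* The left-hand side is the degree of D on the vital curves of type
   (a, b, c, d); the partitions are taken ordered, which is harmless because
   that degree is symmetric in a, b, c, d. *)
Definition Fnef (n : nat) (D : symdiv n) : Prop :=
  forall a b c d : nat,
    (0 < a)%N -> (0 < b)%N -> (0 < c)%N -> (0 < d)%N -> (a + b + c + d)%N = n ->
    bcoef D (a + b) + bcoef D (a + c) + bcoef D (a + d)
      - bcoef D a - bcoef D b - bcoef D c - bcoef D d >= 0.

(* Subsets of the projectivization W of the space of divisor classes are
   represented throughout by the corresponding cones. *)
Definition V (n i : nat) (D : symdiv n) : Prop :=
  bcoef D 2 + 2%:R * bcoef D i.+1 - bcoef D i - bcoef D i.+2 = 0.

(* V_1, ..., V_(k - 2) intersected with the F-nef cone. *)
Definition Fface (n k : nat) (D : symdiv n) : Prop :=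
  (forall i : nat, (1 <= i <= k - 2)%N -> V i D) /\ Fnef D.

Definition simplicial_cone (d : nat) (C : 'rV[rat]_d -> Prop) : Prop :=
  exists (m : nat) (e : m.-tuple 'rV[rat]_d),
    free e /\
    forall x : 'rV[rat]_d,
      C x <-> exists c : 'I_m -> rat,
                (forall i, 0 <= c i) /\ x = \sum_(i < m) c i *: tnth e i.

(* Main.v *)
Require Import Defs.
From HB Require Import structures.
From mathcomp Require Import all_boot all_order all_algebra.
From mathcomp Require Import zify ring lra.

(** Write m = n./2 and k = m - t.  Subtracting from a class the right multiple
    of the symmetric quadratic x * (n - x), on which every vital curve has
    degree 0, turns the condition V_i into the vanishing of the second
    difference at i + 1 of a symmetric function on 0, ..., n.  So the degrees
    on the curves (1, 1, i, n - i - 2), 1 <= i < m, are coordinates on the space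
    of symmetric classes ([flag_degrees_inj]), and the dual basis consists, up
    to scaling, of the truncated tents

      x |-> min (x, n - x, j) - x * (n - x) / (n - 1),   2 <= j <= m

    whose only kinks are at j and n - j ([flag_degree_tent]).  On the face F_k
    the coordinates with i <= k - 2 vanish and the others, being degrees, are
    nonnegative; hence F_k lies in the cone spanned by the tents with
    k <= j <= m.  The converse inclusion asks only that these tents be F-nef.  A
    tent whose plateau is too low is not: at a = b = c = d = n / 4 and
    j <= n / 4 its degree is 3 j - 4 j.  But 3 j >= n suffices
    ([tent_inequality]), and j >= m - t ensures this once n is large with
    respect to t.  So F_k is spanned by t + 1 linearly independent classes. *)

Set Implicit Arguments.
Unset Strict Implicit.
Unset Printing Implicit Defensive.
Import Order.TTheory GRing.Theory Num.Theory.
Local Open Scope ring_scope.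

(** A cone is simplicial as soon as its generators come with coordinate
    functionals: these give both freeness and the coefficients. *)
Lemma simplicial_cone_dual (d m : nat) (C : 'rV[rat]_d -> Prop)
    (e : 'I_m -> 'rV[rat]_d) (l : 'I_m -> 'rV[rat]_d -> rat) :
  (forall c p, l p (\sum_q c q *: e q) = c p) ->
  (forall x, C x -> (forall p, 0 <= l p x) /\ x = \sum_p l p x *: e p) ->
  (forall c, (forall p, 0 <= c p) -> C (\sum_p c p *: e p)) ->
  simplicial_cone C.
Proof.
move=> le Cl Ce; exists m, [tuple e p | p < m]; split.
  apply/freeP => c c0 p; rewrite -(le c p).
  have -> : \sum_q c q *: e q = \sum_q (fun=> 0 : rat) q *: e q.
    under [RHS]eq_bigr do rewrite scale0r.
    rewrite [RHS]big1 // -[RHS]c0; apply: eq_bigr => q _.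
    by rewrite -tnth_nth tnth_mktuple.
  exact: (le (fun=> 0)).
move=> x; split=> [/Cl[l0 xE]|[c [c0 ->]]].
  exists (l^~ x); split=> //; rewrite {1}xE.
  by apply: eq_bigr => p _; rewrite tnth_mktuple.
by under eq_bigr do rewrite tnth_mktuple; apply: Ce.
Qed.

Section BoundaryCoefficients.
Variable n : nat.
Implicit Type D : 'rV[rat]_(n./2.-1).

Lemma bcoef1 D : @bcoef n D 1 = 0.
Proof. by rewrite /bcoef big_pred0 // => i; lia. Qed.

Lemma bcoef_sym D x : (x <= n)%N -> @bcoef n D (n - x) = @bcoef n D x.
Proof. by move=> xn; rewrite /bcoef subKn // minnC. Qed.

Lemma bcoef_coord D (i : 'I_(n./2.-1)) x :
  i.+2 = minn x (n - x) -> @bcoef n D x = D 0 i.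
Proof.
by move=> ix; rewrite /bcoef -ix (big_pred1 i).
Qed.

Lemma bcoef_row (f : nat -> rat) x :
    f 1%N = 0 -> (forall y, (0 < y < n)%N -> f (n - y)%N = f y) ->
  (0 < x < n)%N -> @bcoef n (\row_i f i.+2) x = f x.
Proof.
move=> f1 fsym x0n.
have fmin : f (minn x (n - x)) = f x.
  by rewrite /minn; case: ifP => // _; rewrite fsym.
have [x1|x2] := leqP (minn x (n - x)) 1.
  have min1 : minn x (n - x) = 1%N by lia.
  by rewrite -fmin min1 f1 /bcoef big_pred0 // => i; rewrite min1.
have ltx : ((minn x (n - x)).-2 < n./2.-1)%N by lia.
have ix : (Ordinal ltx).+2 = minn x (n - x) by rewrite /=; lia.
by rewrite (bcoef_coord _ ix) mxE ix fmin.
Qed.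

End BoundaryCoefficients.

Definition curve_form (f : nat -> rat) (a b c d : nat) : rat :=
  f (a + b)%N + f (a + c)%N + f (a + d)%N - f a - f b - f c - f d.

Definition curve_degree (n a b c d : nat) (D : 'rV[rat]_(n./2.-1)) : rat :=
  curve_form (@bcoef n D) a b c d.

Lemma curve_degree_is_linear (n a b c d : nat) :
  linear_for *%R (@curve_degree n a b c d).
Proof.
have lin u D E j : @bcoef n (u *: D + E) j = u * @bcoef n D j + @bcoef n E j.
  rewrite /bcoef mulr_sumr -big_split /=.
  by apply: eq_bigr => i _; rewrite !mxE.
by move=> u D E; rewrite /curve_degree /curve_form !lin; ring.
Qed.

HB.instance Definition _ (n a b c d : nat) :=
  GRing.isLinear.Build rat 'rV[rat]_(n./2.-1) rat *%R
    (@curve_degree n a b c d) (@curve_degree_is_linear n a b c d).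

(** The vital curves of type (1, 1, i, n - i - 2), whose degrees cut out the
    hyperplanes V_i. *)
Definition flag_degree (n i : nat) : 'rV[rat]_(n./2.-1) -> rat :=
  @curve_degree n 1 1 i (n - i - 2).

HB.instance Definition _ (n i : nat) :=
  GRing.Linear.on (@flag_degree n i).

Lemma flag_degreeE (n i : nat) (D : 'rV[rat]_(n./2.-1)) : (i.+2 <= n)%N ->
  flag_degree i D =
    @bcoef n D 2 + 2%:R * @bcoef n D i.+1 - @bcoef n D i - @bcoef n D i.+2.
Proof.
move=> lin; rewrite /flag_degree /curve_degree /curve_form bcoef1 !add1n.
have -> : (n - i - 2).+1 = (n - i.+1)%N by lia.
have -> : (n - i - 2)%N = (n - i.+2)%N by lia.
by rewrite !bcoef_sym //; [ring|lia].
Qed.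

(** If all these degrees vanish then r_x is r_2 times the binomial coefficient
    of x over 2 for x <= n./2; when r_2 is nonzero this contradicts
    r_x = r_(n - x) across the middle, as the last degree (i = n./2 - 1) shows. *)
Lemma flag_degrees_inj (n : nat) (D : 'rV[rat]_(n./2.-1)) :
  (forall i, (0 < i < n./2)%N -> flag_degree i D = 0) -> D = 0.
Proof.
move=> D0.
have [m1|m2] := leqP n./2 1; first by apply/rowP => -[i]; lia.
pose r := @bcoef n D.
have rD i : (0 < i < n./2)%N -> r 2 + 2%:R * r i.+1 - r i - r i.+2 = 0.
  by move=> im; rewrite -(flag_degreeE D) ?D0 //; lia.
have rE x : (x < n./2)%N ->
    r x.+1 = r 2 * (x%:R * x.+1%:R / 2%:R)
    /\ ((x.+1 < n./2)%N -> r x.+2 = r 2 * (x.+1%:R * x.+2%:R / 2%:R)).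
  elim: x => [_|x IHx xm]; first by rewrite /r bcoef1; split=> [|_]; field.
  have [rx1 rx2] := IHx (ltnW xm).
  split=> [|xm']; first exact: rx2.
  have := rD x.+1 (ltac:(lia)).
  rewrite rx1 (rx2 xm) -[x.+3]addn3 -[x.+2]addn2 -[x.+1]addn1 !natrD.
  by move=> eq0; lra.
have r20 : r 2 = 0.
  have [m mE] : exists m, n./2 = m.+2 by exists n./2.-2; lia.
  have [r1 r2] := rE m (ltac:(lia)).
  have := rD m.+1 (ltac:(lia)).
  rewrite r1 r2; last lia.
  (* the reflection of [m.+3] is [m.+1] for n even and [m.+2] for n odd *)
  have -> : r m.+3 = if odd n then r m.+2 else r m.+1.
    rewrite /r -bcoef_sym; last lia.
    by case: ifP => ? ; congr bcoef; lia.
  have m0 : 0 <= m%:R :> rat by [].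
  case: (odd n); rewrite ?r1 ?r2; try lia;
    rewrite -[m.+2]addn2 -[m.+1]addn1 !natrD => eq0.
    have /eqP : r 2 * (m%:R + 2%:R) = 0 by lra.
    by rewrite mulf_eq0 => /orP[/eqP //|/eqP]; lra.
  have /eqP : r 2 * (2%:R * m%:R + 3%:R) = 0 by lra.
  by rewrite mulf_eq0 => /orP[/eqP //|/eqP]; lra.
apply/rowP => i; have lti := ltn_ord i; rewrite mxE.
rewrite -(@bcoef_coord n D i i.+2); last lia.
have [rx _] := rE i.+1 (ltac:(lia)).
by rewrite -/(r _) rx r20 mul0r.
Qed.

Definition tent (n j x : nat) : nat := minn x (minn (n - x) j).

(** For four equal parts and n / 4 <= j <= n / 2 the inequality reads 3 j >= n,
    so the bound on the height of the plateau is sharp. *)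
Lemma tent_inequality (n j a b c d : nat) :
    (n <= 3 * j)%N -> (a + b + c + d)%N = n ->
  (tent n j a + tent n j b + tent n j c + tent n j d <=
     tent n j (a + b) + tent n j (a + c) + tent n j (a + d))%N.
Proof.
move=> jn nE.
(* the smaller side needs only upper bounds on the tents, so that each choice of
   the minima on the larger side leaves one linear inequality *)
have tent_le x y : (x + y)%N = n ->
    [/\ (tent n j x <= x)%N, (tent n j x <= y)%N & (tent n j x <= j)%N].
  by rewrite /tent => ?; split; lia.
have tent_eq x y : (x + y)%N = n ->
    [\/ tent n j x = x, tent n j x = y | tent n j x = j].
  rewrite /tent => ?; case: (leqP x y) => ?.
    by case: (leqP x j) => ?; [constructor 1|constructor 3]; lia.
  by case: (leqP y j) => ?; [constructor 2|constructor 3]; lia.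
have [a1 a2 a3] := tent_le a (b + c + d)%N (ltac:(lia)).
have [b1 b2 b3] := tent_le b (a + c + d)%N (ltac:(lia)).
have [c1 c2 c3] := tent_le c (a + b + d)%N (ltac:(lia)).
have [d1 d2 d3] := tent_le d (a + b + c)%N (ltac:(lia)).
case: (tent_eq (a + b)%N (c + d)%N (ltac:(lia))) => ->;
case: (tent_eq (a + c)%N (b + d)%N (ltac:(lia))) => ->;
case: (tent_eq (a + d)%N (b + c)%N (ltac:(lia))) => ->;
  clear tent_le tent_eq; lia.
Qed.

(** The quadratic term normalizes the entry r_1 to 0. *)
Definition tent_fun (n j x : nat) : rat :=
  (tent n j x)%:R - x%:R * (n%:R - x%:R) / (n%:R - 1).

Definition tent_class (n j : nat) : 'rV[rat]_(n./2.-1) :=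
  \row_i tent_fun n j i.+2.

(** The quadratic term has degree 0 on all vital curves. *)
Lemma curve_degree_tent (n j a b c d : nat) : (0 < j)%N ->
    (0 < a)%N -> (0 < b)%N -> (0 < c)%N -> (0 < d)%N -> (a + b + c + d)%N = n ->
  curve_degree a b c d (tent_class n j) =
  curve_form (fun x => (tent n j x)%:R) a b c d.
Proof.
move=> j0 a0 b0 c0 d0 nE.
have n1 : n%:R - 1 != 0 :> rat.
  by rewrite subr_eq0 (eqr_nat rat n 1); lia.
have bE x : (0 < x < n)%N -> @bcoef n (tent_class n j) x = tent_fun n j x.
  move=> xn; apply: bcoef_row => // [|y yn].
    by rewrite /tent_fun (_ : tent n j 1 = 1%N) /tent; [field|lia].
  rewrite /tent_fun (_ : tent n j (n - y) = tent n j y) /tent; last lia.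
  by rewrite natrB; [ring|lia].
rewrite /curve_degree /curve_form !bE; try lia.
rewrite /tent_fun; move: n1; rewrite -nE !natrD => n1; field.
by move: n1; rewrite -!natrD.
Qed.

(** The second difference of the tent is -1 at its kink j; when j is the middle
    of 0, ..., n, the two kinks j and n - j coincide and add up to -2. *)
Lemma flag_degree_tent (n j i : nat) : (1 < j <= n./2)%N -> (0 < i < n./2)%N ->
  flag_degree i (tent_class n j) =
    if i.+1 == j then (1 + (j.*2 == n))%:R else 0.
Proof.
move=> jm im; rewrite /flag_degree curve_degree_tent; try lia.
have kink : (tent n j (1 + 1) + tent n j (1 + i) + tent n j (1 + (n - i - 2)) =
    (if i.+1 == j then 1 + (j.*2 == n) else 0) + tent n j 1 + tent n j 1
      + tent n j i + tent n j (n - i - 2))%N.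
  have low x : (x <= n./2)%N -> tent n j x = minn x j by rewrite /tent; lia.
  have sym x y : (x + y)%N = n -> tent n j x = tent n j y by rewrite /tent; lia.
  rewrite (sym (1 + (n - i - 2))%N i.+1); last lia.
  have [ij|ij|ij] := ltngtP i.+1 j.
  - by rewrite (sym (n - i - 2)%N i.+2) ?low; lia.
  - rewrite !(low 2, low 1, low i, low i.+1, low (1 + i)%N); try lia.
    rewrite (_ : tent n j (n - i - 2) = (if j.*2 == n then i else j)).
      by case: ifP; lia.
    case: eqP => nj; first by rewrite low; lia.
    by rewrite /tent (minn_idPr _); lia.
  - have [mi|im'] := leqP n./2 i.+1; first by rewrite !low; lia.
    by rewrite (sym (n - i - 2)%N i.+2) ?low; lia.
by rewrite /curve_form -!natrD kink; case: ifP => _; rewrite !natrD; ring.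
Qed.

Theorem theorem6p3 (t : nat) :
  exists N : nat, forall n : nat, (N <= n)%N ->
    simplicial_cone (@Fface n (n./2 - t)%N).
Proof.
(* this makes n./2 - t at least n / 3, as [tent_inequality] requires *)
exists (6 * t + 6)%N => n Nn.
(* the tents and their coordinates are listed from the middle outwards *)
pose w (p : 'I_t.+1) : rat := (1 + ((n./2 - p).*2 == n))%:R.
pose l (p : 'I_t.+1) (D : 'rV[rat]_(n./2.-1)) :=
  flag_degree (n./2 - p).-1 D / w p.
have tent_coord (c : 'I_t.+1 -> rat) i : (0 < i < n./2)%N ->
    flag_degree i (\sum_(p < t.+1) c p *: tent_class n (n./2 - p)) =
    \sum_(p < t.+1 | i.+1 == (n./2 - p)%N) c p * w p.
  move=> im; rewrite linear_sum [RHS]big_mkcond /=; apply: eq_bigr => p _.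
  have ltp := ltn_ord p.
  rewrite linearZ /= flag_degree_tent ?im //; last lia.
  by case: eqP => _; rewrite /w ?mulr0.
have lK (c : 'I_t.+1 -> rat) p :
    l p (\sum_(q < t.+1) c q *: tent_class n (n./2 - q)) = c p.
  have ltp := ltn_ord p.
  rewrite /l tent_coord; last lia.
  rewrite (big_pred1 p) => [|q]; first by rewrite mulfK // /w pnatr_eq0.
  by have ltq := ltn_ord q; rewrite /= -val_eqE /=; lia.
apply: (simplicial_cone_dual lK) => [D [DV Dnef]|c c0].
  have D0 p : 0 <= l p D.
    have ltp := ltn_ord p.
    by apply: divr_ge0 => //; apply: Dnef; lia.
  split=> //; apply/eqP; rewrite -subr_eq0; apply/eqP.
  apply: flag_degrees_inj => i im; rewrite linearB /= tent_coord //.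
  have [it|it] := leqP i (n./2 - t - 2).
    rewrite big_pred0 => [|p]; last by have ltp := ltn_ord p; lia.
    by rewrite subr0 flag_degreeE; [apply: DV|]; lia.
  have ltp : (n./2 - i.+1 < t.+1)%N by lia.
  rewrite (big_pred1 (Ordinal ltp)) => [|q]; last first.
    by have ltq := ltn_ord q; rewrite /= -val_eqE /=; lia.
  rewrite /l divfK /= ?pnatr_eq0 //.
  by rewrite (_ : (n./2 - (n./2 - i.+1)).-1 = i) ?subrr //; lia.
split=> [i ik|a b c' d a0 b0 c'0 d0 nE].
  rewrite /V -flag_degreeE ?tent_coord; try lia.
  by rewrite big_pred0 // => p; have ltp := ltn_ord p; lia.
rewrite -[X in 0 <= X]/(curve_degree a b c' d _) linear_sum.
apply: sumr_ge0 => p _; have ltp := ltn_ord p.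
rewrite linearZ /= mulr_ge0 // curve_degree_tent //; last lia.
have := @tent_inequality n (n./2 - p) a b c' d (ltac:(lia)) nE.
by rewrite /curve_form -(ler_nat rat) !natrD; lra.
Qed.
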